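(* Let $G$ be a subgroup of the symmetric group $S_m$, let $U$ and $V$ be unitary spaces with orthonormal bases $\{u_1,\dots,u_d\}$ and $\{e_1,\dots,e_n\}$ respectively, and let $\mathfrak{X}$ be an irreducible unitary representation of $G$ over $U$. For any $1\le j,s\le m$, $1\le i,r\le n$, $1\le k,l\le d$, we have $$\langle C_{\mathfrak{X}}(u_k\otimes e_{ij}),\, C_{\mathfrak{X}}(u_l\otimes e_{rs})\rangle=\begin{cases}0 & \text{if } s\nsim j,\\[2mm] \delta_{ir}\,\dfrac{|G_{sj}|}{|G|}\,\langle T_{sj}u_k,u_l\rangle & \text{if } s\sim j.\end{cases}$$ In particular, $$\|C_{\mathfrak{X}}(u_k\otimes e_{ij})\|^2=\frac{1}{[G:G_j]}\,\|T_ju_k\|^2.$$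
   Context: A unitary space is a finite-dimensional complex vector space equipped with an inner product (linear in the first argument). A unitary representation of $G$ over $U$ is a group homomorphism from $G$ to the unitary operators on $U$. $\times^{m}V$ denotes the Cartesian product of $m$ copies of $V$. The space $U\otimes\times^{m}V$ carries the inner product determined by $\langle u\otimes x^\times, v\otimes y^\times\rangle=\langle u,v\rangle\sum_{i=1}^m\langle x_i,y_i\rangle$. For $\sigma\in G$, $Q(\sigma)(v_1,\dots,v_m)=(v_{\sigma^{-1}(1)},\dots,v_{\sigma^{-1}(m)})$ on $\times^m V$, and the generalized Cartesian symmetrizer is $C_{\mathfrak{X}}=\frac{1}{|G|}\sum_{\sigma\in G}\mathfrak{X}(\sigma)\otimes Q(\sigma)$. For $1\le i\le n$, $1\le j\le m$, $e_{ij}=(\delta_{1j}e_i,\delta_{2j}e_i,\dots,\delta_{mj}e_i)\in\times^m V$ (the tuple with $e_i$ in position $j$ and $0$ elsewhere). Here $\delta$ is the Kronecker delta. Write $s\sim j$ if $s$ and $j$ lie in the same orbit of $G$ on $\{1,\dots,m\}$, and $s\nsim j$ otherwise. $G_{sj}=\{\sigma\in G: \sigma(j)=s\}$, and $T_{sj}=\frac{1}{|G_{sj}|}\sum_{\sigma\in G_{sj}}\mathfrak{X}(\sigma)$, with $T_{sj}=0$ if $G_{sj}$ is empty. $G_j=G_{jj}$ is the stabilizer of $j$ in $G$ and $T_j=T_{jj}=\frac{1}{|G_j|}\sum_{\sigma\in G_j}\mathfrak{X}(\sigma)$. *)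

(* Defs.v *)
From HB Require Import structures.
From mathcomp Require Import all_boot all_order all_algebra all_fingroup.
From mathcomp Require Import ring.

Set Implicit Arguments.
Unset Strict Implicit.
Unset Printing Implicit Defensive.

Import Order.TTheory GRing.Theory Num.Theory Num.Def.
Local Open Scope ring_scope.

(* A unitary space is a vectType over C together with a form
   [dot : {dot U for conjC}]: positive definite, hermitian and, in the
   conventions of sesquilinear.v, linear in its first argument.  Everything up
   to the symmetrizer makes sense over any numClosedFieldType. *)

Section UnitarySpaces.
Variables (C : numClosedFieldType) (U : vectType C) (dot : {dot U for conjC}).

Definition hnorm (x : U) : C := sqrtC (dot x x).

Definition orthonormal_basis (d : nat) (b : d.-tuple U) : bool :=
  basis_of fullv b && orthonormal dot b.

Definition unitary_op (f : 'End(U)) : Prop :=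
  (f @: fullv = fullv)%VS /\ isometry dot dot f.

Lemma ex_orthogonal_basis :
  {b : seq U | pairwise_orthogonal dot b & <<b>>%VS = fullv}.
Proof.
suffices [b ob sb]: {b : seq U | pairwise_orthogonal dot b
    & <<b>>%VS = <<vbasis (fullv : {vspace U})>>%VS}.
  by exists b; rewrite // sb (span_basis (vbasisP _)).
elim: (vbasis _ : seq U) => [|x s [b ob sb]]; first by exists [::].
have [y by_ [z [Dx _ oz]]] := orthogonal_split dot b x.
have [z0|nz] := eqVneq z 0.
  exists b => //; rewrite sb span_cons addvC; apply/esym/addv_idPl.
  by rewrite -sb Dx z0 addr0 -memvE.
exists (z :: b).
  case/andP: ob => nb ob.
  rewrite /pairwise_orthogonal inE negb_or eq_sym nz nb /= ob andbT.
  exact: oz.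
rewrite !span_cons -sb Dx.
apply/eqP; rewrite eqEsubv !subv_add !addvSr -!memvE !andbT.
apply/andP; split.
  have {1}-> : z = (y + z) - y by rewrite addrAC subrr add0r.
  by rewrite memv_add ?memv_line ?memvN.
by rewrite addrC memv_add ?memv_line.
Qed.

End UnitarySpaces.

(* The tensor product of two finite-dimensional spaces, realized as matrices of
   coordinates; [tensor_universal] shows it is a tensor product. *)

Definition tensor (C : numClosedFieldType) (U W : vectType C) : Type :=
  'M[C]_(\dim {:U}, \dim {:W}).

HB.instance Definition _ (C : numClosedFieldType) (U W : vectType C) :=
  Vector.copy (tensor U W) 'M[C]_(\dim {:U}, \dim {:W}).

Section Coordinates.
Variables (C : numClosedFieldType) (V : vectType C).

Definition ebasis (i : 'I_(\dim {:V})) : V := (vbasis fullv)`_i.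
Definition ecoord (i : 'I_(\dim {:V})) (x : V) : C := coord (vbasis fullv) i x.

Lemma ecoordP a x y i : ecoord i (a *: x + y) = a * ecoord i x + ecoord i y.
Proof. exact: linearP. Qed.

Lemma sum_ecoord (x : V) : x = \sum_i ecoord i x *: ebasis i.
Proof. by rewrite {1}(coord_vbasis (memvf x)). Qed.

Lemma ecoord_ebasis i j : ecoord i (ebasis j) = (i == j)%:R.
Proof. by rewrite /ecoord coord_free ?(basis_free (vbasisP _)) // eq_sym. Qed.

End Coordinates.

Section Tensor.
Variables (C : numClosedFieldType) (U W : vectType C).

Definition tens (x : U) (y : W) : tensor U W :=
  \matrix_(i, j) (ecoord i x * ecoord j y).

Fact tens_is_bilinear :
  (forall y, GRing.linear_for *:%R (tens ^~ y))
  * (forall x, GRing.linear_for *:%R (tens x)).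
Proof.
split=> z a x y; apply/matrixP => i j; rewrite !mxE ecoordP.
  by rewrite mulrDl mulrA.
by rewrite mulrDr mulrCA.
Qed.

HB.instance Definition _ :=
  bilinear_isBilinear.Build C U W (tensor U W) _ _ tens tens_is_bilinear.

Lemma tensor_decomp (t : tensor U W) :
  t = \sum_i \sum_j t i j *: tens (ebasis i) (ebasis j).
Proof.
rewrite {1}[t]matrix_sum_delta; apply: eq_bigr => i _; apply: eq_bigr => j _.
congr (_ *: _); apply/matrixP => k l.
by rewrite !mxE !ecoord_ebasis -natrM mulnb.
Qed.

Lemma tensor_universal (Z : lmodType C) (f : {bilinear U -> W -> Z}) :
  exists g : {linear tensor U W -> Z},
    (forall x y, g (tens x y) = f x y) /\
    (forall h : {linear tensor U W -> Z},
       (forall x y, h (tens x y) = f x y) -> h =1 g).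
Proof.
pose g (t : tensor U W) : Z := \sum_i \sum_j t i j *: f (ebasis i) (ebasis j).
have g_lin : linear g.
  move=> a x y; rewrite /g scaler_sumr -big_split; apply: eq_bigr => i _ /=.
  rewrite scaler_sumr -big_split; apply: eq_bigr => j _ /=.
  by rewrite !mxE scalerDl scalerA.
pose gL := GRing.isLinear.Build C (tensor U W) Z _ g g_lin.
pose G : {linear tensor U W -> Z} := HB.pack g gL.
have GE x y : G (tens x y) = f x y.
  rewrite [x in RHS]sum_ecoord [y in RHS]sum_ecoord linear_sumlz.
  apply: eq_bigr => i _; rewrite linear_sumr; apply: eq_bigr => j _.
  by rewrite linearZl_LR linearZr_LR scalerA !mxE.
exists G; split=> // h hE t.
rewrite [t]tensor_decomp !linear_sum; apply: eq_bigr => i _.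
rewrite !linear_sum; apply: eq_bigr => j _.
by rewrite !linearZ /= hE -GE.
Qed.

End Tensor.

Section TensorMap.
Variables (C : numClosedFieldType) (U W : vectType C).

Definition tensf_fun (f : 'End(U)) (g : 'End(W)) (t : tensor U W) :
  tensor U W := \sum_i \sum_j t i j *: tens (f (ebasis i)) (g (ebasis j)).

Fact tensf_is_linear f g : linear (tensf_fun f g).
Proof.
move=> a x y; rewrite /tensf_fun scaler_sumr -big_split.
apply: eq_bigr => i _ /=; rewrite scaler_sumr -big_split.
by apply: eq_bigr => j _ /=; rewrite !mxE scalerDl scalerA.
Qed.

HB.instance Definition _ f g :=
  GRing.isLinear.Build C (tensor U W) (tensor U W) _ (tensf_fun f g)
    (tensf_is_linear f g).

Definition tensf (f : 'End(U)) (g : 'End(W)) : 'End(tensor U W) :=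
  linfun (tensf_fun f g).

Lemma tensfE f g x y : tensf f g (tens x y) = tens (f x) (g y).
Proof.
rewrite lfunE /= /tensf_fun [x in RHS]sum_ecoord [y in RHS]sum_ecoord.
rewrite !linear_sum linear_sumlz; apply: eq_bigr => i _.
rewrite linear_sumr; apply: eq_bigr => j _.
by rewrite !linearZ /= linearZl_LR /= !mxE scalerA mulrC.
Qed.

End TensorMap.

Section TensorDot.
Variables (C : numClosedFieldType) (U W : vectType C).
Variables (dotU : {dot U for conjC}) (dotW : {dot W for conjC}).

(* The sesquilinear extension of <x (x) y, x' (x) y'> = <x, x'> <y, y'>,
   see [tensor_dotE]. *)
Definition tensor_dot (s t : tensor U W) : C :=
  \sum_i \sum_j \sum_k \sum_l s i j * (t k l)^* *
     (dotU (ebasis i) (ebasis k) * dotW (ebasis j) (ebasis l)).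

Fact tensor_dot_is_linearl t :
  GRing.linear_for *%R (fun s => tensor_dot s t).
Proof.
move=> a x y; rewrite /tensor_dot.
do 4![rewrite mulr_sumr -big_split; apply: eq_bigr => ? _ /=].
by rewrite !mxE mulrDl mulrDl !mulrA.
Qed.

Fact tensor_dotC s t : tensor_dot s t = (-1) ^+ false * (tensor_dot t s)^*.
Proof.
rewrite expr0 mul1r /tensor_dot.
pose F k l i j := s i j * (t k l)^* *
     (dotU (ebasis i) (ebasis k) * dotW (ebasis j) (ebasis l)).
transitivity (\sum_k \sum_l \sum_i \sum_j F k l i j).
  transitivity (\sum_i \sum_k \sum_j \sum_l F k l i j).
    by apply: eq_bigr => i _; rewrite exchange_big.
  rewrite exchange_big; apply: eq_bigr => k _ /=.
  transitivity (\sum_i \sum_l \sum_j F k l i j).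
    by apply: eq_bigr => i _; rewrite exchange_big.
  by rewrite exchange_big.
rewrite /F.
do 4![rewrite rmorph_sum; apply: eq_bigr => ? _ /=].
rewrite !rmorphM /= conjCK mulrC [in RHS]mulrC; congr (_ * _); last exact: mulrC.
by rewrite hermC expr0 mul1r; congr (_ * _); rewrite hermC expr0 mul1r.
Qed.

Fact tensor_dot_is_bilinear :
  (forall u', GRing.linear_for *%R (tensor_dot ^~ u'))
  * (forall u, GRing.linear_for (conjC \; *%R) (tensor_dot u)).
Proof.
split=> t; first exact: tensor_dot_is_linearl.
move=> a x y /=; rewrite tensor_dotC tensor_dot_is_linearl expr0 mul1r.
rewrite rmorphD rmorphM /=; congr (_ * _ + _).
  by rewrite [RHS]tensor_dotC expr0 mul1r.
by rewrite [RHS]tensor_dotC expr0 mul1r.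
Qed.

HB.instance Definition _ := bilinear_isBilinear.Build C (tensor U W)
  (tensor U W) C _ _ tensor_dot tensor_dot_is_bilinear.

HB.instance Definition _ := isHermitianSesquilinear.Build C (tensor U W)
  false conjC tensor_dot tensor_dotC.

Lemma tensor_dotE x y x' y' :
  tensor_dot (tens x y) (tens x' y') = dotU x x' * dotW y y'.
Proof.
rewrite [x in RHS]sum_ecoord [y in RHS]sum_ecoord.
rewrite !linear_sumlz mulr_suml; apply: eq_bigr => i _.
rewrite mulr_sumr; apply: eq_bigr => j _.
rewrite [x' in RHS]sum_ecoord [y' in RHS]sum_ecoord.
rewrite !linear_sumr mulr_suml; apply: eq_bigr => k _.
rewrite mulr_sumr; apply: eq_bigr => l _.
rewrite !linearZl_LR /= !linearZr_LR /= !mxE rmorphM /=.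
ring.
Qed.

Lemma tensor_split (b : seq W) (t : tensor U W) : <<b>>%VS = fullv ->
  exists x : 'I_(size b) -> U, t = \sum_q tens (x q) b`_q.
Proof.
move=> sb; pose c (j : 'I_(\dim {:W})) q := coord (in_tuple b) q (ebasis j).
exists (fun q => \sum_i \sum_j (t i j * c j q) *: ebasis i).
rewrite {1}[t]tensor_decomp.
under [RHS]eq_bigr do rewrite linear_sumlz.
rewrite [RHS]exchange_big; apply: eq_bigr => i _ /=.
under [RHS]eq_bigr do rewrite linear_sumlz.
rewrite [RHS]exchange_big; apply: eq_bigr => j _ /=.
have {1}-> : ebasis j = \sum_q c j q *: b`_q.
  by rewrite {1}[ebasis j](@coord_span _ _ _ (in_tuple b)) //= sb memvf.
rewrite linear_sumr scaler_sumr; apply: eq_bigr => q _.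
by rewrite linearZl_LR linearZr_LR /= scalerA.
Qed.

Fact tensor_dot_gt0 t : t != 0 -> 0 < tensor_dot t t.
Proof.
move=> nz; have [b ob sb] := ex_orthogonal_basis dotW.
have [x Dt] := tensor_split t sb.
have [/pairwise_orthogonalP [/andP[/= nb ub] ob']] := ob.
have bnz (q : 'I_(size b)) : b`_q != 0.
  by apply: contraNneq nb => <-; rewrite mem_nth.
have -> : tensor_dot t t = \sum_q dotU (x q) (x q) * dotW b`_q b`_q.
  rewrite Dt linear_sumlz; apply: eq_bigr => q _.
  rewrite linear_sumr (bigD1 q) //= tensor_dotE big1 ?addr0 // => r neq.
  rewrite tensor_dotE ob' ?mem_nth ?mulr0 // nth_uniq //.
  by rewrite eq_sym.
have ge0 q : 0 <= dotU (x q) (x q) * dotW b`_q b`_q.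
  by rewrite mulr_ge0 ?dnorm_ge0.
rewrite lt_def sumr_ge0 // andbT psumr_neq0 //; apply/hasP.
have [q xq|x0] := pickP (fun q => x q != 0).
  by exists q; rewrite ?mem_index_enum //= mulr_gt0 ?dnorm_gt0.
case/eqP: nz; rewrite Dt big1 // => q _.
by have /negbFE/eqP-> := x0 q; rewrite linear0l.
Qed.

HB.instance Definition _ := isDotProduct.Build C (tensor U W)
  tensor_dot tensor_dot_gt0.

End TensorDot.

Section CartesianPower.
Variables (C : numClosedFieldType) (V : vectType C) (m : nat).

Definition perm_fun (s : 'S_m) (v : {ffun 'I_m -> V}) : {ffun 'I_m -> V} :=
  [ffun i => v ((s^-1)%g i)].

Fact perm_fun_is_linear s : linear (perm_fun s).
Proof. by move=> a x y; apply/ffunP => i; rewrite !ffunE. Qed.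

HB.instance Definition _ s :=
  GRing.isLinear.Build C {ffun 'I_m -> V} {ffun 'I_m -> V} _ (perm_fun s)
    (perm_fun_is_linear s).

Definition Qop (s : 'S_m) : 'End({ffun 'I_m -> V}) := linfun (perm_fun s).

Definition evec (x : V) (j : 'I_m) : {ffun 'I_m -> V} :=
  [ffun q => (q == j)%:R *: x].

Variable dot : {dot V for conjC}.

Definition cart_dot (x y : {ffun 'I_m -> V}) : C := \sum_i dot (x i) (y i).

Fact cart_dot_is_bilinear :
  (forall y, GRing.linear_for *%R (cart_dot ^~ y))
  * (forall x, GRing.linear_for (conjC \; *%R) (cart_dot x)).
Proof.
split=> z a x y; rewrite /cart_dot /= mulr_sumr -big_split;
  apply: eq_bigr => i _ /=; rewrite !ffunE.
  by rewrite linearPl.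
by rewrite linearPr.
Qed.

HB.instance Definition _ := bilinear_isBilinear.Build C {ffun 'I_m -> V}
  {ffun 'I_m -> V} C _ _ cart_dot cart_dot_is_bilinear.

Fact cart_dotC x y : cart_dot x y = (-1) ^+ false * (cart_dot y x)^*.
Proof.
rewrite expr0 mul1r rmorph_sum; apply: eq_bigr => i _.
by rewrite hermC expr0 mul1r.
Qed.

HB.instance Definition _ := isHermitianSesquilinear.Build C {ffun 'I_m -> V}
  false conjC cart_dot cart_dotC.

Fact cart_dot_gt0 x : x != 0 -> 0 < cart_dot x x.
Proof.
move=> nz; rewrite lt_def sumr_ge0 => [|i _]; last exact: dnorm_ge0.
rewrite andbT psumr_neq0 => [|i _]; last exact: dnorm_ge0.
apply/hasP; have [i xi|x0] := pickP (fun i => x i != 0).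
  by exists i; rewrite ?mem_index_enum //= dnorm_gt0.
case/eqP: nz; apply/ffunP => i; rewrite ffunE; apply/eqP.
exact: negbFE (x0 i).
Qed.

HB.instance Definition _ := isDotProduct.Build C {ffun 'I_m -> V}
  cart_dot cart_dot_gt0.

End CartesianPower.

Section Symmetrizer.
Variables (C : numClosedFieldType) (U V : vectType C) (m : nat).
Variables (dotU : {dot U for conjC}) (G : {group 'S_m}) (X : 'S_m -> 'End(U)).

(* Only the values of [X] on [G] matter.  In perm.v, [(s * t) i = t (s i)], so
   the composite of s after t, written st in the usual notation for
   permutations, is [(t * s)%g]. *)
Definition unitary_repr : Prop :=
  [/\ X 1%g = \1%VF,
      {in G &, forall s t, X (t * s)%g = (X s \o X t)%VF}
    & {in G, forall s, unitary_op dotU (X s)}].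

Definition irreducible_repr : Prop :=
  (fullv : {vspace U}) != 0%VS /\
  forall W : {vspace U},
    {in G, forall s, (X s @: W <= W)%VS} -> W = 0%VS \/ W = fullv.

Definition symmetrizer : 'End(tensor U {ffun 'I_m -> V}) :=
  #|G|%:R^-1 *: \sum_(s in G) tensf (X s) (Qop V s).

Definition Gset (s j : 'I_m) : {set 'S_m} := [set g in G | g j == s].

(* When [Gset s j] is empty the sum, hence [Tavg s j], is 0. *)
Definition Tavg (s j : 'I_m) : 'End(U) :=
  #|Gset s j|%:R^-1 *: \sum_(g in Gset s j) X g.

End Symmetrizer.

(* Main.v *)
Require Import Defs.
From mathcomp Require Import all_boot all_order all_algebra all_fingroup.
From mathcomp Require Import reals.
From mathcomp Require Import complex.
From mathcomp Require Import ring.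

Set Implicit Arguments.
Unset Strict Implicit.
Unset Printing Implicit Defensive.

Import Order.TTheory GRing.Theory Num.Theory Num.Def.
Local Open Scope ring_scope.

(** Expanding both symmetrizers, the inner product of
    [C(x tensor v_j)] and [C(y tensor w_s)], where [v_j] has [v] in place [j],
    is [|G|^-2] times the sum over [g, h] in [G] of
    [<X(g) x, X(h) y> <v, w>] restricted to the pairs with [g(j) = h(s)].
    Since [X(h)] is an isometry, [<X(g) x, X(h) y> = <X(h^-1 g) x, y>], and the
    restriction also concerns only the composite [h^-1 g], which must send [j]
    to [s].  Each element of [G] is such a composite for exactly [|G|] pairs
    (this is [sum_dot_repr]), so what remains is [|G|^-1 <v, w>] times the sum
    of [<X(g) x, y>] over [g] in [G_sj], that is,
    [<v, w> |G_sj|/|G| <T_sj x, y>] ([dot_symmetrizer]).  Orthonormality of the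
    basis of [V] turns [<v, w>] into a Kronecker delta, and [G_sj] is empty
    when [s] is not in the orbit of [j].

    The same collapse of double sums, applied to the stabilizer [G_j] with no
    restriction on the pairs, gives [<T_j x, T_j x> = <T_j x, x>]
    ([dot_Tavg_stab]): averaging over a group is an orthogonal projection.
    With [x = y] and [s = j] this is the norm formula. *)

(** * Inner products of averages and of coordinate vectors *)

Section DotSums.
Variables (C : numClosedFieldType) (U V : vectType C) (m : nat).
Variables (dotU : {dot U for conjC}) (dotV : {dot V for conjC}).

Lemma hnormK (x : U) : hnorm dotU x ^+ 2 = dotU x x.
Proof. exact: sqrtCK. Qed.

Lemma dot_avg (I : Type) (r : seq I) (P : pred I) (F : I -> U) (J : Type)
    (r' : seq J) (Q : pred J) (F' : J -> U) (a b : nat) :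
  dotU (a%:R^-1 *: \sum_(i <- r | P i) F i)
       (b%:R^-1 *: \sum_(j <- r' | Q j) F' j) =
  a%:R^-1 * b%:R^-1 *
    \sum_(i <- r | P i) \sum_(j <- r' | Q j) dotU (F i) (F' j).
Proof.
rewrite linearZl_LR linearZr_LR /= fmorphV rmorph_nat mulrA; congr (_ * _).
by rewrite linear_sumlz; apply: eq_bigr => i _; rewrite linear_sumr.
Qed.

Lemma Qop_evec (s : 'S_m) (x : V) (j : 'I_m) :
  Qop V s (evec x j) = evec x (s j).
Proof.
by rewrite lfunE; apply/ffunP => q; rewrite !ffunE (canF_eq (permKV s)).
Qed.

Lemma cart_dot_evec (x y : V) (j q : 'I_m) :
  cart_dot dotV (evec x j) (evec y q) = (j == q)%:R * dotV x y.
Proof.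
rewrite /cart_dot (bigD1 j) //= big1 => [|i /negPf ij].
  by rewrite addr0 !ffunE eqxx scale1r linearZr_LR /= rmorph_nat.
by rewrite !ffunE ij scale0r linear0l.
Qed.

Lemma orthonormal_dot (n : nat) (e : n.-tuple V) (i r : 'I_n) :
  orthonormal dotV e -> dotV (tnth e i) (tnth e r) = (i == r)%:R.
Proof.
move=> oe; have /orthonormalP [ue /(_ _ _ (mem_tnth i e) (mem_tnth r e))->] := oe.
by rewrite (inj_eq (tuple_uniqP _ ue)).
Qed.

End DotSums.

(** * Averages of a unitary representation *)

Section UnitaryAverages.
Variables (C : numClosedFieldType) (U : vectType C) (m : nat).
Variables (dotU : {dot U for conjC}) (X : 'S_m -> 'End(U)).

Lemma unitary_reprS (H G : {group 'S_m}) :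
  H \subset G -> unitary_repr dotU G X -> unitary_repr dotU H X.
Proof.
move=> /subsetP sHG [X1 XM XU]; split=> // [s t /sHG Gs /sHG Gt|s /sHG].
  exact: XM.
exact: XU.
Qed.

(** Writing [s = g * t], which is the composite of [t] after [g], the isometry
    [X t] cancels from [<X s x, X t y>] and leaves [<X g x, y>], which no longer
    depends on [t]; the weight [phi] is evaluated at [g]. *)
Lemma sum_dot_repr (H : {group 'S_m}) (phi : 'S_m -> C) (x y : U) :
    unitary_repr dotU H X ->
  \sum_(s in H) \sum_(t in H) phi (s * t^-1)%g * dotU (X s x) (X t y) =
  #|H|%:R * \sum_(g in H) phi g * dotU (X g x) y.
Proof.
move=> [_ XM XU]; rewrite exchange_big mulr_natl -sumr_const.
apply: eq_bigr => t Ht; rewrite (reindex_inj (mulIg t)) /=.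
apply: eq_big => [g|g]; rewrite groupMr // => Hg.
by rewrite mulgK XM // comp_lfunE (proj2 (XU t Ht)).
Qed.

(** Clearing the denominator makes the identity hold uniformly, including the
    case where no element of [G] sends [j] to [s]. *)
Lemma dot_Tavg (G : {group 'S_m}) (s j : 'I_m) (x y : U) :
  #|Gset G s j|%:R * dotU (Tavg G X s j x) y =
  \sum_(g in G) (g j == s)%:R * dotU (X g x) y.
Proof.
rewrite scale_lfunE sum_lfunE linearZl_LR /= linear_sumlz mulrA.
transitivity (\sum_(g in Gset G s j) dotU (X g x) y).
  have [->|[g Gg]] := set_0Vmem (Gset G s j); first by rewrite !big_set0 mulr0.
  rewrite divff ?mul1r // pnatr_eq0 -lt0n; apply/card_gt0P; by exists g.
rewrite big_mkcond [RHS]big_mkcond; apply: eq_bigr => g _ /=.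
rewrite inE; case: (g \in G) => //=.
by case: (g j == s); rewrite ?mul1r ?mul0r.
Qed.

Lemma Gset_stab (G : {group 'S_m}) (j : 'I_m) : Gset G j j = 'C_G[j | 'P]%g.
Proof.
by apply/setP => g; rewrite !inE sub1set inE.
Qed.

(** [Tavg G X j j] averages over the stabilizer of [j], a subgroup, so it is the
    orthogonal projection onto the vectors that this subgroup fixes. *)
Lemma dot_Tavg_stab (G : {group 'S_m}) (j : 'I_m) (x : U) :
    unitary_repr dotU G X ->
  dotU (Tavg G X j j x) (Tavg G X j j x) = dotU (Tavg G X j j x) x.
Proof.
rewrite /Tavg Gset_stab; set H := 'C_G[j | 'P]%G => hX.
have hH : unitary_repr dotU H X by apply: unitary_reprS hX; apply: subsetIl.
have nzH : #|H|%:R != 0 :> C by rewrite pnatr_eq0 -lt0n cardG_gt0.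
rewrite !scale_lfunE !sum_lfunE dot_avg linearZl_LR /= linear_sumlz -mulrA.
congr (_ * _); apply: (canLR (mulKf nzH)).
transitivity (\sum_(g in H) \sum_(h in H) 1 * dotU (X g x) (X h x)).
  by do 2![apply: eq_bigr => ? _]; rewrite mul1r.
rewrite (sum_dot_repr (fun=> 1) x x hH); congr (_ * _).
by apply: eq_bigr => g _; rewrite mul1r.
Qed.

End UnitaryAverages.

(** * The symmetrizer *)

Lemma symmetrizer_tens_evec (C : numClosedFieldType) (U V : vectType C)
    (m : nat) (G : {group 'S_m}) (X : 'S_m -> 'End(U)) (x : U) (v : V)
    (j : 'I_m) :
  symmetrizer V G X (tens x (evec v j)) =
  #|G|%:R^-1 *: \sum_(g in G) tens (X g x) (evec v (g j)).
Proof.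
rewrite scale_lfunE sum_lfunE; congr (_ *: _).
by apply: eq_bigr => g _; rewrite tensfE Qop_evec.
Qed.

(** Expanding both symmetrizers gives a double sum over [g] and [h] in [G] in
    which only the pairs with [g j = h s] survive, because the coordinate
    vectors supported at different places are orthogonal.  That condition reads
    [(g * h^-1) j = s], so it depends on [g * h^-1] alone and the double sum
    collapses by [sum_dot_repr]. *)
Lemma dot_symmetrizer (C : numClosedFieldType) (U V : vectType C) (m : nat)
    (dotU : {dot U for conjC}) (dotV : {dot V for conjC}) (G : {group 'S_m})
    (X : 'S_m -> 'End(U)) (x y : U) (v w : V) (j s : 'I_m) :
    unitary_repr dotU G X ->
  tensor_dot dotU (cart_dot (m := m) dotV)
    (symmetrizer V G X (tens x (evec v j)))
    (symmetrizer V G X (tens y (evec w s))) =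
  dotV v w * (#|Gset G s j|%:R / #|G|%:R) * dotU (Tavg G X s j x) y.
Proof.
move=> hX; have nzG : #|G|%:R != 0 :> C by rewrite pnatr_eq0 -lt0n cardG_gt0.
rewrite !symmetrizer_tens_evec dot_avg.
transitivity (#|G|%:R^-1 * #|G|%:R^-1 * (dotV v w *
    \sum_(g in G) \sum_(h in G)
      ((g * h^-1)%g j == s)%:R * dotU (X g x) (X h y))).
  congr (_ * _); rewrite mulr_sumr; apply: eq_bigr => g _.
  rewrite mulr_sumr; apply: eq_bigr => h _.
  rewrite [LHS]tensor_dotE [X in _ * X = _]cart_dot_evec.
  by rewrite permM (canF_eq (permKV h)); ring.
rewrite (sum_dot_repr (fun g : 'S_m => (g j == s)%:R) _ _ hX) -dot_Tavg.
by field.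
Qed.

Theorem theorem2p2 (R : realType) (m d n : nat) (G : {group 'S_m})
  (U V : vectType R[i])
  (dotU : {dot U for conjC}) (dotV : {dot V for conjC})
  (u : d.-tuple U) (e : n.-tuple V) (X : 'S_m -> 'End(U))
  (hu : orthonormal_basis dotU u) (he : orthonormal_basis dotV e)
  (hX : unitary_repr dotU G X) (hirr : irreducible_repr G X) :
  let dotT := tensor_dot dotU (cart_dot (m := m) dotV) in
  let CX := symmetrizer V G X in
  (forall (j s : 'I_m) (i r : 'I_n) (k l : 'I_d),
     dotT (CX (tens (tnth u k) (evec (tnth e i) j)))
          (CX (tens (tnth u l) (evec (tnth e r) s))) =
     if s \in orbit 'P G j then
       (i == r)%:R * (#|Gset G s j|%:R / #|G|%:R)
         * dotU (Tavg G X s j (tnth u k)) (tnth u l)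
     else 0)
  /\
  (forall (j : 'I_m) (i : 'I_n) (k : 'I_d),
     hnorm dotT (CX (tens (tnth u k) (evec (tnth e i) j))) ^+ 2 =
     #|G : Gset G j j|%g%:R^-1 * hnorm dotU (Tavg G X j j (tnth u k)) ^+ 2).
Proof.
split=> [j s i r k l|j i k].
  rewrite dot_symmetrizer // orthonormal_dot; last by case/andP: he.
  have [//|s_j] := ifPn.
  suffices -> : Gset G s j = set0 by rewrite cards0 mul0r mulr0 mul0r.
  apply/setP => g; rewrite !inE; apply: contraNF s_j => /andP[Gg /eqP <-].
  exact: mem_orbit.
rewrite !hnormK [LHS]dot_symmetrizer // orthonormal_dot; last by case/andP: he.
rewrite eqxx mul1r dot_Tavg_stab // Gset_stab; congr (_ * _).
(* The index is the quotient of orders because the stabilizer is a subgroup. *)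
rewrite -(Lagrange (subsetIl G 'C[j | 'P]%g)) natrM.
by rewrite invfM mulrA divff ?mul1r // pnatr_eq0 -lt0n cardG_gt0.
Qed.
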